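(* Fix $n,K,T\in\mathbb{Z}_{+}$ and any product distribution $\mathcal{D}=\mathcal{D}_1\times\cdots\times\mathcal{D}_n$ of bidders' values as in the context. Suppose each bidder $i\in[n]$ runs the Meta-Algorithm with an online learning algorithm $\mathcal{A}_i$ (over $K+1$ actions) whose regret is at most $\mathrm{Reg}_{\mathcal{A}_i}$ for every (possibly adaptively chosen) sequence of reward vectors in $[-1,1]^{K+1}$. Suppose that in every round $t\in[T]$ the auctioneer chooses an auction format $\mathcal{M}^{(t)}=(\mathbf{x}^{(t)},\mathbf{p}^{(t)})$ satisfying allocation monotonicity and voluntary participation (the choice may be randomized and may depend adaptively on everything observed so far, including the bidders' current strategies). Then the auctioneer's expected cumulative revenue satisfies \[ \mathbb{E}\Big[\sum_{t\in[T]}\sum_{i\in[n]}p_i^{(t)}(\mathbf{b}^{(t)})\Big]\le \mathrm{Mye}(\mathcal{D})\cdot T+\sum_{i\in[n]}\mathrm{Reg}_{\mathcal{A}_i}. \]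
   Context: Setting. There are $n$ bidders. Bidder $i$'s value $v_i\in[0,1]$ is drawn independently from a continuous distribution $\mathcal{D}_i$ on $[0,1]$ with CDF $F_i$; $F_i^{-1}(y):=\inf\{v\in[0,1]:F_i(v)\ge y\}$ is its quantile function and $\mathcal{D}:=\mathcal{D}_1\times\cdots\times\mathcal{D}_n$. The bid set is $B:=\{j/K: j=0,\dots,K\}$. A bidding strategy is any function $s:[0,1]\to B$; it is monotone if $v\le v'$ implies $s(v)\le s(v')$. For a vector $\mathbf{b}$ we write $(b_i,\mathbf{b}_{-i})$ to separate coordinate $i$ from the others. An allocation vector lies in $\Delta([n])$, the set of vectors with nonnegative entries summing to at most $1$ (entry $i$ is the probability bidder $i$ gets the item). Repeated auction game over $T$ rounds: in round $t$ each bidder $i$ selects a bidding strategy $s_i^{(t)}$; then the auctioneer selects an auction format $\mathcal{M}^{(t)}=(\mathbf{x}^{(t)},\mathbf{p}^{(t)})$ with $\mathbf{x}^{(t)}:B^n\to\Delta([n])$ and $\mathbf{p}^{(t)}:B^n\to[0,1]^n$; then $\mathbf{v}^{(t)}\sim\mathcal{D}$ is drawn fresh and independently, bids are $b_i^{(t)}=s_i^{(t)}(v_i^{(t)})$, and $\mathbf{b}^{(t)}$ and $\mathcal{M}^{(t)}$ are revealed; bidder $i$ receives the item w.p. $x_i^{(t)}(\mathbf{b}^{(t)})$ and pays $p_i^{(t)}(\mathbf{b}^{(t)})$. Formats must satisfy: (allocation monotonicity) for all $i$, $\mathbf{b}_{-i}\in B^{n-1}$, $b_i\le b_i'$ in $B$: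 $x_i^{(t)}(b_i,\mathbf{b}_{-i})\le x_i^{(t)}(b_i',\mathbf{b}_{-i})$; (voluntary participation) $p_i^{(t)}(0,\mathbf{b}_{-i})=0$ for all $i,\mathbf{b}_{-i}$. Utility of bidder $i$ in round $t$ for a strategy $s$: $u_i^{(t)}(s):=\mathbb{E}_{v_i\sim\mathcal{D}_i}[x_i^{(t)}(s(v_i),\mathbf{b}_{-i}^{(t)})v_i-p_i^{(t)}(s(v_i),\mathbf{b}_{-i}^{(t)})]$, where $\mathbf{b}_{-i}^{(t)}$ are the realized bids of the others. Quantile strategies. A quantile strategy is $\boldsymbol{\pi}\in\Delta([K+1])$ (the probability simplex in $\mathbb{R}^{K+1}$). Write $\Pi_0:=0$, $\Pi_j:=\sum_{\ell=1}^j\pi_\ell$. For bidder $i$, the monotone strategy $s_{i,\boldsymbol{\pi}}$ is: $s_{i,\boldsymbol{\pi}}(v)=0$ if $v\in[0,F_i^{-1}(\Pi_1)]$, and $s_{i,\boldsymbol{\pi}}(v)=\frac{j-1}{K}$ if $v\in(F_i^{-1}(\Pi_{j-1}),F_i^{-1}(\Pi_j)]$ for $j\in\{2,\dots,K+1\}$. The quantile utility is $q_i^{(t)}(\boldsymbol{\pi}):=u_i^{(t)}(s_{i,\boldsymbol{\pi}})$. Define the vector $\mathbf{g}_i^{(t)}(\boldsymbol{\pi})\in\mathbb{R}^{K+1}$ by, for $k\in[K+1]$, \[ g_{i,k}^{(t)}(\boldsymbol{\pi}):=\sum_{j=k}^{K}\Big(x_i^{(t)}\big(\tfrac{j-1}{K},\mathbf{b}_{-i}^{(t)}\big)-x_i^{(t)}\big(\tfrac{j}{K},\mathbf{b}_{-i}^{(t)}\big)\Big)F_i^{-1}(\Pi_j)+x_i^{(t)}(1,\mathbf{b}_{-i}^{(t)})-p_i^{(t)}\big(\tfrac{k-1}{K},\mathbf{b}_{-i}^{(t)}\big)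 \] (this is the gradient of $q_i^{(t)}$). Online learning. An algorithm $\mathcal{A}$ over $K+1$ actions outputs in each round $t$ a distribution $\boldsymbol{\pi}^{(t)}\in\Delta([K+1])$, then observes a reward vector $\mathbf{r}^{(t)}\in[-1,1]^{K+1}$. Its regret is $\max_{j\in[K+1]}\sum_{t\in[T]}(r_j^{(t)}-\sum_k\pi_k^{(t)}r_k^{(t)})$; saying it has regret at most $\mathrm{Reg}_{\mathcal{A}}$ means this bound holds for every reward sequence. Meta-Algorithm (for bidder $i$, input $\mathcal{A}$ and $F_i$): in each round $t$, $\mathcal{A}$ outputs $\boldsymbol{\pi}^{(i,t)}\in\Delta([K+1])$; bidder $i$ plays $s_i^{(t)}:=s_{i,\boldsymbol{\pi}^{(i,t)}}$; after the round, the reward vector $\mathbf{r}^{(t)}:=\mathbf{g}_i^{(t)}(\boldsymbol{\pi}^{(i,t)})$ is fed to $\mathcal{A}$. Myerson benchmark. A (continuous) auction $\mathcal{M}=(\mathbf{x},\mathbf{p})$ has $\mathbf{x}:[0,1]^n\to\Delta([n])$, $\mathbf{p}:[0,1]^n\to[0,1]^n$. It is IR if $x_i(v_i,\mathbf{b}_{-i})v_i-p_i(v_i,\mathbf{b}_{-i})\ge0$ for all $i,v_i,\mathbf{b}_{-i}$, and IC if $x_i(v_i,\mathbf{b}_{-i})v_i-p_i(v_i,\mathbf{b}_{-i})\ge x_i(b_i,\mathbf{b}_{-i})v_i-p_i(b_i,\mathbf{b}_{-i})$ for all $i,v_i,b_i,\mathbf{b}_{-i}$. Its revenue is $\mathrm{Rev}_{\mathcal{M}}(\mathcal{D}):=\mathbb{E}_{\mathbf{v}\sim\mathcal{D}}[\sum_i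 p_i(\mathbf{v})]$, and $\mathrm{Mye}(\mathcal{D})$ is the supremum of $\mathrm{Rev}_{\mathcal{M}}(\mathcal{D})$ over IC and IR auctions. *)

(* Defs.v *)
From HB Require Import structures.
From mathcomp Require Import all_boot all_order all_algebra.
From mathcomp Require Import all_classical all_reals all_analysis.
Set Implicit Arguments. Unset Strict Implicit. Unset Printing Implicit Defensive.
Import Order.TTheory GRing.Theory Num.Theory.
Local Open Scope classical_set_scope.
Local Open Scope ring_scope.

(* Bids.  The bid set B = {j/K : j = 0..K} is represented by its index *)
(* set 'I_K.+1 (index j <-> bid j/K); the order on indices is the      *)
(* order on bids.  A bid profile is an element of B^n.                 *)
Definition bidval (R : realType) (K : nat) (j : nat) : R := j%:R / K%:R.

Definition profile (n K : nat) := {ffun 'I_n -> 'I_K.+1}.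

Definition upd (n K : nat) (b : profile n K) (i : 'I_n) (c : 'I_K.+1)
  : profile n K := [ffun j => if j == i then c else b j].

Record format (n K : nat) (R : realType) := Format {
  fx : profile n K -> 'I_n -> R ;
  fp : profile n K -> 'I_n -> R
}.

Definition valid_format (n K : nat) (R : realType) (M : format n K R) : Prop :=
  [/\ (forall b i, 0 <= fx M b i),
      (forall b, \sum_(i < n) fx M b i <= 1),
      (forall b i, 0 <= fp M b i <= 1),
      (forall i b (c c' : 'I_K.+1), (c <= c')%N ->
          fx M (upd b i c) i <= fx M (upd b i c') i) &
      (forall i b, fp M (upd b i ord0) i = 0)].

Definition cdf (R : realType) (mu : probability R R) (v : R) : R :=
  fine (mu `]-oo, v]%classic).

Definition quantile (R : realType) (mu : probability R R) (y : R) : R :=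
  inf [set v : R | 0 <= v <= 1 /\ y <= cdf mu v].

(* Quantile strategies.  pi : {ffun 'I_K.+1 -> R}; the paper's pi_j     *)
(* (j in [K+1]) is pi (j-1).  Pi j = pi_1 + ... + pi_j.                  *)
Definition Pi (R : realType) (K : nat) (pi : {ffun 'I_K.+1 -> R}) (j : nat) : R :=
  \sum_(l < K.+1 | (l < j)%N) pi l.

Definition qinterval (R : realType) (K : nat) (mu : probability R R)
    (pi : {ffun 'I_K.+1 -> R}) (k : 'I_K.+1) (v : R) : bool :=
  if (k == 0 :> nat) then (0 <= v) && (v <= quantile mu (Pi pi 1))
  else (quantile mu (Pi pi k) < v) && (v <= quantile mu (Pi pi k.+1)).

(* s_{i,pi}(v), as a bid index (bid 0 outside the intervals, a null set) *)
Definition qstrat (R : realType) (K : nat) (mu : probability R R)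
    (pi : {ffun 'I_K.+1 -> R}) (v : R) : 'I_K.+1 :=
  odflt ord0 [pick k : 'I_K.+1 | qinterval mu pi k v].

(* The reward vector g_i^{(t)}(pi), 0-indexed (entry k <-> paper's k+1). *)
(* x c = x_i^{(t)}(c/K, b_{-i}^{(t)}),  p c = p_i^{(t)}(c/K, b_{-i}^{(t)}). *)
Definition greward (R : realType) (K : nat) (mu : probability R R)
    (x p : nat -> R) (pi : {ffun 'I_K.+1 -> R}) : {ffun 'I_K.+1 -> R} :=
  [ffun k : 'I_K.+1 =>
     \sum_(j < K.+1 | (k < j)%N) (x j.-1 - x j) * quantile mu (Pi pi j)
     + x K - p k].

(* Online learning over K+1 actions: a (deterministic) algorithm maps   *)
(* the chronological history of reward vectors to a distribution.       *)
Definition algo (K : nat) (R : realType) :=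
  seq {ffun 'I_K.+1 -> R} -> {ffun 'I_K.+1 -> R}.

Definition in_simplex (R : realType) (K : nat) (pi : {ffun 'I_K.+1 -> R}) : Prop :=
  (forall k, 0 <= pi k) /\ \sum_(k < K.+1) pi k = 1.

Definition regret_le (R : realType) (K : nat) (A : algo K R) (T : nat) (Reg : R)
  : Prop :=
  forall r : nat -> {ffun 'I_K.+1 -> R},
    (forall t k, (t < T)%N -> -1 <= r t k <= 1) ->
    forall j : 'I_K.+1,
      \sum_(t < T) (r t j - \sum_(k < K.+1) A (mkseq r t) k * r t k) <= Reg.

Definition updv (R : realType) (n : nat) (v : 'I_n -> R) (i : 'I_n) (c : R)
  : 'I_n -> R := fun j => if j == i then c else v j.

Fixpoint prodE_l (R : realType) (n : nat) (D : 'I_n -> probability R R)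
    (l : seq 'I_n) (f : ('I_n -> R) -> R) (v : 'I_n -> R) : R :=
  match l with
  | [::] => f v
  | i :: l' => Rintegral (D i) setT (fun c => prodE_l D l' f (updv v i c))
  end.

Definition prodE (R : realType) (n : nat) (D : 'I_n -> probability R R)
    (f : ('I_n -> R) -> R) : R :=
  prodE_l D (enum 'I_n) f (fun _ => 0).

Record cauction (n : nat) (R : realType) := CAuction {
  cx : ('I_n -> R) -> 'I_n -> R ;
  cp : ('I_n -> R) -> 'I_n -> R
}.

Definition in01 (R : realType) (n : nat) (v : 'I_n -> R) : Prop :=
  forall j, 0 <= v j <= 1.

Definition cauction_wf (n : nat) (R : realType) (M : cauction n R) : Prop :=
  forall v, in01 v ->
    [/\ (forall i, 0 <= cx M v i), \sum_(i < n) cx M v i <= 1 &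
        (forall i, 0 <= cp M v i <= 1)].

Definition IR (n : nat) (R : realType) (M : cauction n R) : Prop :=
  forall (i : 'I_n) v, in01 v -> 0 <= cx M v i * v i - cp M v i.

Definition IC (n : nat) (R : realType) (M : cauction n R) : Prop :=
  forall (i : 'I_n) v (c : R), in01 v -> 0 <= c <= 1 ->
    cx M (updv v i c) i * v i - cp M (updv v i c) i
      <= cx M v i * v i - cp M v i.

Definition Rev (n : nat) (R : realType) (D : 'I_n -> probability R R)
    (M : cauction n R) : R :=
  prodE D (fun v => \sum_(i < n) cp M v i).

Definition Mye (n : nat) (R : realType) (D : 'I_n -> probability R R) : R :=
  sup [set r : R | exists M : cauction n R,
         [/\ cauction_wf M, IC M, IR M & r = Rev D M]].

(* The repeated game.  Given the auctioneer's (seed-fixed) adaptive     *)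
(* policy  auct : (history of bid profiles, latest first) -> format,    *)
(* and the learners A_i, everything is a deterministic function of the  *)
(* realized bid history.                                                 *)
Fixpoint rewards (n K : nat) (R : realType) (D : 'I_n -> probability R R)
    (A : 'I_n -> algo K R) (auct : seq (profile n K) -> format n K R)
    (i : 'I_n) (h : seq (profile n K)) : seq {ffun 'I_K.+1 -> R} :=
  match h with
  | [::] => [::]
  | b :: h' =>
      let r := rewards D A auct i h' in
      let M := auct h' in
      rcons r (greward (D i)
                 (fun c => fx M (upd b i (inord c)) i)
                 (fun c => fp M (upd b i (inord c)) i)
                 (A i r))
  end.

Definition strat (n K : nat) (R : realType) (D : 'I_n -> probability R R)
    (A : 'I_n -> algo K R) (auct : seq (profile n K) -> format n K R)
    (i : 'I_n) (h : seq (profile n K)) : R -> 'I_K.+1 :=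
  qstrat (D i) (A i (rewards D A auct i h)).

Definition bids (n K : nat) (R : realType) (D : 'I_n -> probability R R)
    (A : 'I_n -> algo K R) (auct : seq (profile n K) -> format n K R)
    (h : seq (profile n K)) (v : 'I_n -> R) : profile n K :=
  [ffun i => strat D A auct i h (v i)].

Fixpoint exp_rev (n K : nat) (R : realType) (D : 'I_n -> probability R R)
    (A : 'I_n -> algo K R) (auct : seq (profile n K) -> format n K R)
    (t : nat) (h : seq (profile n K)) : R :=
  match t with
  | 0 => 0
  | t'.+1 =>
      prodE D (fun v =>
        let b := bids D A auct h v in
        \sum_(i < n) fp (auct h) b i + exp_rev D A auct t' (b :: h))
  end.

(* Main.v *)
(** Fix a round, a bidder and the bids of the others, and let [x j], [p j] be
    the allocation and payment at bid j/K and [Q j] the quantile at which the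
    strategy starts bidding j/K.  Charging the increments of [x] at the
    thresholds [Q j] gives a payment rule that is truthful for the composed
    mechanism "value, then quantile strategy, then format".  Up to a constant
    the reward vector of the learner is this threshold payment minus [p], so the
    expected excess of [p] over the threshold payment is exactly the round's
    regret against always bidding 0.  The threshold payments of all bidders
    together are at most the Myerson revenue, and along every realized history
    the regret terms add up to at most the regret bound of the learner. *)
Require Import Defs.
From HB Require Import structures.
From mathcomp Require Import all_boot all_order all_algebra.
From mathcomp Require Import all_classical all_reals all_analysis.
From mathcomp Require Import measurable_realfun ring lra.
Import Order.TTheory GRing.Theory Num.Theory.
Import numFieldNormedType.Exports HBNNSimple Defs.
Local Open Scope classical_set_scope.
Local Open Scope ring_scope.
Set Implicit Arguments. Unset Strict Implicit. Unset Printing Implicit Defensive.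

(** * Integrals and quantiles *)

Lemma measure_setC_eq0 {d} {T : measurableType d} {R : realType}
    (P : probability T R) (A : set T) :
  measurable A -> P A = 1%E -> P (~` A) = 0%E.
Proof. by move=> mA PA; rewrite probability_setC// PA subee. Qed.

Lemma le_measure_full {d} {T : measurableType d} {R : realType}
    (P : probability T R) (A B : set T) :
  measurable A -> measurable B -> P A = 1%E -> A `<=` B -> P B = 1%E.
Proof.
move=> mA mB PA AB; apply/eqP; rewrite eq_le probability_le1//= -PA.
by apply: le_measure => //; rewrite inE.
Qed.

(* [f] is not assumed measurable: its integral is then a difference of suprema
   over simple functions, and the bounds survive. *)
Lemma Rintegral_bounded {d} {T : measurableType d} {R : realType}
    (P : probability T R) (A : set T) (f : T -> R) (C : R) :
  measurable A -> P A = 1%E -> 0 <= C ->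
  (forall x, A x -> 0 <= f x <= C) -> 0 <= Rintegral P setT f <= C.
Proof.
move=> mA PA C0 fC.
(* A simple function below [g] is at most [c] on [A], and the complement of [A] is null; so the
   supremum of the integrals of such functions is at most [c]. *)
have nnint (g : T -> \bar R) (c : R) : 0 <= c -> (forall x, 0 <= g x)%E ->
    (forall x, A x -> g x <= c%:E)%E ->
    (0 <= \int[P]_x g x <= c%:E)%E.
  move=> c0 g0 gc; rewrite integral_ge0//= ge0_integralTE//.
  apply: ge_ereal_sup => _ [h /= hg <-].
  have -> : sintegral P h = (\int[P]_x (h x)%:E)%E.
    by rewrite integral_nnsfun//; apply: eq_sintegral => x; rewrite patch_setT.
  rewrite (@ge0_negligible_integral _ _ _ _ _ (~` A))//=.
  - apply: (@le_trans _ _ (\int[P]_(x in setT `\` ~` A) cst c%:E x)%E).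
      apply: ge0_le_integral => //=.
      + by apply: measurableD => //; exact: measurableC.
      + by move=> x _; rewrite lee_fin.
      + by apply/measurable_EFinP; exact: measurable_funTS.
      + move=> x [_ /contrapT Ax]; exact: le_trans (hg x) (gc x Ax).
    by rewrite setTD setCK integral_cst// [X in (_ * X)%E]PA mule1.
  - exact: measurableC.
  - exact/measurable_EFinP.
  - by move=> x _; rewrite lee_fin.
  - exact: measure_setC_eq0.
rewrite /Rintegral integralE.
have /andP[p0 pC] : (0 <= \int[P]_x ((EFin \o f)^\+ x) <= C%:E)%E.
  apply: nnint => // x /fC/andP[f0 fC'].
  by rewrite funeposE/= ge_max !lee_fin fC' C0.
have /andP[n0 nC] : (0 <= \int[P]_x ((EFin \o f)^\- x) <= 0)%E.
  apply: nnint => // x /fC/andP[f0 fC'].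
  by rewrite funenegE/= ge_max !lee_fin oppr_le0 f0 lexx.
have -> : (\int[P]_x ((EFin \o f)^\- x) = 0)%E.
  by apply/eqP; rewrite eq_le n0 nC.
rewrite sube0; move: p0 pC; case: (\int[P]_x _)%E => //= r.
by rewrite !lee_fin => -> ->.
Qed.

Section Quantile.
Context {R : realType} (mu : probability R R).
Hypothesis mu01 : mu `[0, 1]%classic = 1%E.
Hypothesis mu_atomless : forall x : R, mu [set x] = 0%E.

Lemma cdfE (x : R) : (cdf mu x)%:E = mu `]-oo, x]%classic.
Proof. by rewrite /cdf fineK// fin_num_measure. Qed.

Lemma cdf_le (x y : R) : x <= y -> cdf mu x <= cdf mu y.
Proof.
move=> xy; rewrite -lee_fin !cdfE; apply: le_measure; rewrite ?inE//.
by apply: subset_itvl; rewrite bnd_simp.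
Qed.

Lemma cdf1 : cdf mu 1 = 1.
Proof.
apply/EFin_inj; rewrite cdfE; apply: (le_measure_full _ _ mu01) => //.
by apply: subset_itvr; rewrite bnd_simp.
Qed.

Lemma cdf_lt0 (x : R) : x < 0 -> cdf mu x = 0.
Proof.
move=> x0; apply/EFin_inj; rewrite cdfE.
apply/eqP; rewrite eq_le measure_ge0 andbT.
apply: (@le_trans _ _ (mu (~` `[0, 1]%classic))); last first.
  by rewrite measure_setC_eq0.
apply: le_measure; rewrite ?inE//; first exact: measurableC.
move=> y /=; rewrite !in_itv/= => yx; apply/negP.
by rewrite negb_and -ltNge (le_lt_trans yx x0).
Qed.

Lemma mu_itvNyo (x : R) : mu `]-oo, x[%classic = (cdf mu x)%:E.
Proof.
rewrite cdfE -(@setUitv1 _ _ -oo%O x true)// measureU//.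
  by rewrite [X in (_ + X)%E]mu_atomless adde0.
by apply/seteqP; split => // y [] /=; rewrite in_itv/= => + yx; rewrite yx ltxx.
Qed.

Let level y : set R := [set v : R | 0 <= v <= 1 /\ y <= cdf mu v].

(** For [y <= 1] the point 1 lies in the level set, so [inf] is a genuine infimum and not a default
    value. *)
Let has_inf_level y : y <= 1 -> has_inf (level y).
Proof.
move=> y1; split; first by exists 1; split; rewrite ?ler01 ?lexx// cdf1.
by exists 0 => v [/andP[]].
Qed.

Lemma quantile_ge0 y : y <= 1 -> 0 <= quantile mu y.
Proof.
move=> y1; apply: lb_le_inf; first by case: (has_inf_level y1).
by move=> v [/andP[]].
Qed.

Lemma quantile_le1 y : y <= 1 -> quantile mu y <= 1.
Proof.
move=> y1; apply: ge_inf; first by case: (has_inf_level y1).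
by split; rewrite ?ler01 ?lexx// cdf1.
Qed.

Lemma quantile_le x y : x <= y -> y <= 1 -> quantile mu x <= quantile mu y.
Proof.
move=> xy y1; apply: lb_le_inf; first by case: (has_inf_level y1).
move=> v [v01 yv]; apply: ge_inf; last by split=> //; exact: le_trans yv.
by case: (has_inf_level (le_trans xy y1)).
Qed.

(* Absence of atoms makes the distribution function continuous, hence onto. *)
Lemma cdf_quantile y : 0 <= y <= 1 -> cdf mu (quantile mu y) = y.
Proof.
move=> /andP[y0 y1]; set q := quantile mu y.
have inv0 (m : nat) : 0 < m.+1%:R^-1 :> R by rewrite invr_gt0 ltr0n.
apply/eqP; rewrite eq_le; apply/andP; split.
(* Upper bound: the half-lines ending at [q - 1/(m+1)] exhaust the open half-line below [q]. Their
   ends lie outside the level set, so each has mass at most [y]; a negative end gives mass 0. *)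
- rewrite -lee_fin -mu_itvNyo -[`]-oo, q[%classic]setCK setCitvl itvcyEbigcap setC_bigcap.
  under eq_bigcupr do rewrite setCitvr.
  apply: (cvge_to_le (@nondecreasing_cvg_mu _ _ _ mu
    (fun k => `]-oo, q - k.+1%:R^-1]%classic) _ _ _)).
  + by [].
  + exact: bigcup_measurable.
  + move=> a b ab; apply/subsetPset; apply: subset_itvl.
    by rewrite bnd_simp lerD2l lerN2 lef_pV2 ?posrE// ler_nat.
  + apply: nearW => m /=; rewrite -cdfE lee_fin.
    have [qm0|qm0] := ltP (q - m.+1%:R^-1) 0; first by rewrite cdf_lt0.
    rewrite leNgt; apply/negP => /ltW yq.
    have : q <= q - m.+1%:R^-1.
      apply: ge_inf; first by case: (has_inf_level y1).
      split=> //; rewrite qm0/= (le_trans _ (quantile_le1 y1))//.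
      by rewrite gerBl ltW.
    by rewrite leNgt gtrBl inv0.
(* Lower bound: below every [q + 1/(m+1)] there is a point of the level set, so each of the
   decreasing half-lines has mass at least [y]. *)
- rewrite -lee_fin cdfE (itvNycEbigcap true).
  apply: (cvge_to_ge (@nonincreasing_cvg_mu _ _ _ mu
    (fun k => `]-oo, q + k.+1%:R^-1[%classic) _ _ _ _)).
  + by apply: (@le_lt_trans _ _ 1%E); rewrite ?ltry// probability_le1.
  + by [].
  + exact: bigcap_measurable.
  + move=> a b ab; apply/subsetPset; apply: subset_itvl.
    by rewrite bnd_simp lerD2l lef_pV2 ?posrE// ler_nat.
  + apply: nearW => m /=; rewrite [leRHS]mu_itvNyo lee_fin.
    have /(inf_lt (has_inf_level y1).1) [v [_ yv] vq] : inf (level y) < q + m.+1%:R^-1.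
      by rewrite ltrDl.
    exact: le_trans yv (cdf_le (ltW vq)).
Qed.
End Quantile.

(** * Quantile strategies *)

Section Simplex.
Context {R : realType} {K : nat} (pi : {ffun 'I_K.+1 -> R}).
Hypothesis pi_simplex : in_simplex pi.

Lemma Pi0 : Pi pi 0 = 0.
Proof. by rewrite /Pi big_pred0. Qed.

Lemma PiS (k : 'I_K.+1) : Pi pi k.+1 = Pi pi k + pi k.
Proof.
rewrite /Pi (bigD1 k)//= addrC; congr (_ + _); apply: eq_bigl => l.
by rewrite ltnS ltn_neqAle andbC.
Qed.

Lemma Pi_full : Pi pi K.+1 = 1.
Proof. by rewrite -pi_simplex.2; apply: eq_bigl => l; rewrite ltn_ord. Qed.

Lemma Pi_le (a b : nat) : (a <= b)%N -> Pi pi a <= Pi pi b.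
Proof.
move=> ab; rewrite /Pi [leRHS](bigID (fun l : 'I_K.+1 => (l < a)%N))/=.
under [X in _ <= X + _]eq_bigl => l.
  rewrite (_ : _ && _ = (l < a)%N); first over.
  by apply: andb_idl => la; exact: leq_trans ab.
by rewrite lerDl sumr_ge0// => l _; exact: pi_simplex.1.
Qed.

Lemma Pi_ge0 (j : nat) : 0 <= Pi pi j.
Proof. by rewrite -Pi0 Pi_le. Qed.

Lemma Pi_le1 (j : nat) : (j <= K.+1)%N -> Pi pi j <= 1.
Proof. by move=> jK; rewrite -Pi_full Pi_le. Qed.

End Simplex.

Lemma Rintegral_sum_indic {d} {T : measurableType d} {R : realType}
    (P : probability T R) (I : Type) (r : seq I) (a : I -> R) (A : I -> set T) :
  (forall i, measurable (A i)) ->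
  Rintegral P setT (fun x => \sum_(i <- r) a i * \1_(A i) x)
    = \sum_(i <- r) a i * fine (P (A i)).
Proof.
move=> mA.
have intA i : P.-integrable setT (EFin \o (fun x => a i * \1_(A i) x)).
  apply: (eq_integrable _ (fun x => (a i)%:E * (\1_(A i) x)%:E)%E) => //.
  by apply: integrableZl => //; exact: integrable_indic.
elim: r => [|i r IHr].
  under eq_Rintegral do rewrite big_nil.
  by rewrite big_nil Rintegral_cst// mul0r.
under eq_Rintegral do rewrite big_cons.
rewrite (RintegralD measurableT (intA i)); last first.
  rewrite (_ : EFin \o _ = fun x => (\sum_(j <- r) (a j * \1_(A j) x)%:E)%E).
    by apply: integrable_sum => // j _; exact: intA.
  by apply/funext => x /=; rewrite sumEFin.
rewrite big_cons IHr; congr (_ + _).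
rewrite RintegralZl//; last exact: integrable_indic.
by rewrite /Rintegral integral_indic// setIT.
Qed.

(** Bid 0 absorbs the mass left by the other bids: [H] composed with [sigma] is [H ord0] plus
    [H k - H ord0] on each fibre over [k != ord0]. So the fibre over 0, which contains the fallback
    points of [qstrat], never has to be described. *)
Lemma Rintegral_finite_law {d} {T : measurableType d} {R : realType}
    (P : probability T R) {K : nat} (sigma : T -> 'I_K.+1)
    (pi : {ffun 'I_K.+1 -> R}) :
  in_simplex pi ->
  (forall k, k != ord0 -> measurable [set x | sigma x = k]) ->
  (forall k, k != ord0 -> P [set x | sigma x = k] = (pi k)%:E) ->
  forall H : 'I_K.+1 -> R,
    Rintegral P setT (fun x => H (sigma x)) = \sum_k pi k * H k.
Proof.
move=> [_ pi1] msigma Psigma H.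
pose A (k : 'I_K.+1) := if k == ord0 then setT else [set x | sigma x = k].
pose a k := if k == ord0 then H ord0 else H k - H ord0.
have HE x : H (sigma x) = \sum_k a k * \1_(A k) x.
  rewrite (bigD1 ord0)//= /A /a eqxx indicT mulr1.
  have [sx|s0] := eqVneq (sigma x) ord0.
    rewrite sx big1 ?addr0// => k k0; rewrite (negbTE k0) indicE memNset ?mulr0//=.
    by rewrite sx; apply/eqP; rewrite eq_sym.
  rewrite (bigD1 (sigma x))//= (negbTE s0) indicE mem_set// mulr1 big1.
    by rewrite addr0 addrC subrK.
  move=> k /andP[k0 ks]; rewrite (negbTE k0) indicE memNset ?mulr0//=.
  by apply/eqP; rewrite eq_sym.
under eq_Rintegral do rewrite HE.
rewrite Rintegral_sum_indic; last by move=> k; rewrite /A; case: eqVneq => // /msigma.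
have -> : \sum_k pi k * H k = H ord0 + \sum_(k | k != ord0) pi k * (H k - H ord0).
  transitivity (\sum_k (pi k * H ord0 + pi k * (H k - H ord0))).
    by apply: eq_bigr => k _; rewrite -mulrDr addrC subrK.
  rewrite big_split/= -mulr_suml pi1 mul1r; congr (_ + _).
  by rewrite (bigD1 ord0)//= subrr mulr0 add0r.
rewrite (bigD1 ord0)//= /A /a eqxx probability_setT mulr1; congr (_ + _).
by apply: eq_bigr => k k0; rewrite (negbTE k0) Psigma//= mulrC.
Qed.

(* [qstrat] falls back to bid 0 above the last quantile, so it is monotone only
   almost everywhere; this variant has the same law and is monotone everywhere,
   which exact incentive compatibility requires. *)
Definition thstrat {R : realType} (K : nat) (Q : nat -> R) (v : R) : 'I_K.+1 :=
  [arg max_(k > ord0 | (k == 0%N :> nat) || (Q k < v)%R) (k : nat)]%N.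

(** Since [Q] is nondecreasing, the indices with threshold below [v] form an initial segment; its
    maximum reaches [j] iff [j] belongs to it. *)
Lemma thstratP {R : realType} (K : nat) (Q : nat -> R) (v : R) (j : nat) :
  (forall a b, (a <= b <= K)%N -> Q a <= Q b) -> (0 < j <= K)%N ->
  (j <= thstrat K Q v)%N = (Q j < v).
Proof.
move=> Qle /andP[j0 jK]; rewrite /thstrat; case: arg_maxnP => //= k kP kmax.
apply/idP/idP => [jk|Qj].
  have := kP; rewrite eqn0Ngt (leq_trans j0 jk)/=; apply: le_lt_trans.
  by apply: Qle; rewrite jk -ltnS ltn_ord.
by rewrite -[j](@inordK K j) ?ltnS// kmax// inordK ?ltnS// Qj orbT.
Qed.

Section QuantileStrategies.
Context {R : realType} (mu : probability R R).
Hypothesis mu01 : mu `[0, 1]%classic = 1%E.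
Hypothesis mu_atomless : forall x : R, mu [set x] = 0%E.
Context {K : nat} (pi : {ffun 'I_K.+1 -> R}).
Hypothesis pi_simplex : in_simplex pi.

Let Q (j : nat) := quantile mu (Pi pi j).

Lemma quantile_Pi_le (a b : nat) : (a <= b <= K.+1)%N -> Q a <= Q b.
Proof.
by move=> /andP[ab bK]; apply: quantile_le => //; [exact: Pi_le|exact: Pi_le1].
Qed.

Lemma cdf_quantile_Pi (j : nat) : (j <= K.+1)%N -> cdf mu (Q j) = Pi pi j.
Proof. by move=> jK; rewrite cdf_quantile// Pi_ge0// Pi_le1. Qed.

(** [cdf] undoes [quantile], so the mass is [Pi pi k.+1 - Pi pi k]. This is why the weight on an
    action is the probability of the corresponding bid. *)
Lemma mu_quantile_interval (k : 'I_K.+1) :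
  mu `]Q k, Q k.+1]%classic = (pi k)%:E.
Proof.
have kK : (k < K.+1)%N := ltn_ord k.
have Qk : Q k <= Q k.+1 by apply: quantile_Pi_le; rewrite leqnSn.
have -> : `]Q k, Q k.+1]%classic = `]-oo, Q k.+1]%classic `\` `]-oo, Q k]%classic.
  apply/seteqP; split => x /=; rewrite !in_itv/=.
    by move=> /andP[kx ->]; split=> //; apply/negP; rewrite -ltNge.
  by move=> [-> /negP]; rewrite -ltNge => ->.
rewrite measureD//; last by apply: (@le_lt_trans _ _ 1%E); rewrite ?ltry// probability_le1.
rewrite (_ : _ `&` _ = `]-oo, Q k]%classic); last first.
  by apply/setIidr; apply: subset_itvl; rewrite bnd_simp.
transitivity ((cdf mu (Q k.+1))%:E - (cdf mu (Q k))%:E)%E; first by rewrite !cdfE.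
by rewrite !cdf_quantile_Pi ?(ltnW kK)// -EFinB PiS addrAC subrr add0r.
Qed.

Lemma qstratE (k : 'I_K.+1) : k != ord0 ->
  [set v | qstrat mu pi v = k] = `]Q k, Q k.+1]%classic.
Proof.
move=> k0; have nk0 : (k == 0 :> nat) = false by exact: negbTE.
apply/seteqP; split => v /=; rewrite in_itv/=.
  rewrite /qstrat; case: pickP => [j + /= jk|_ /= k0']; last by rewrite -k0' in k0.
  by rewrite jk /qinterval nk0.
(* [pick] returns some interval containing [v]; monotone quantiles force it to be the one of index
   [k]. *)
move=> /andP[kv vk]; rewrite /qstrat; case: pickP => [j|/(_ k)]; last first.
  by rewrite /qinterval nk0 kv vk.
have upper : v <= Q j.+1 -> (k <= j)%N.
  move=> vj; rewrite leqNgt; apply/negP => jk.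
  have : Q j.+1 <= Q k by apply: quantile_Pi_le; rewrite jk ltnW.
  by move=> /(le_trans vj); rewrite leNgt kv.
rewrite /qinterval/=; case: ifP => [/eqP j0 /andP[_ vj]|_ /andP[jv vj]].
  by have := upper; rewrite j0 => /(_ vj); rewrite leqn0 nk0.
apply/val_inj/eqP; rewrite eqn_leq upper// andbT leqNgt; apply/negP => kj.
have : Q k.+1 <= Q j by apply: quantile_Pi_le; rewrite kj ltnW.
by move=> /(le_trans vk); rewrite leNgt jv.
Qed.

Lemma Rintegral_qstrat (H : 'I_K.+1 -> R) :
  Rintegral mu setT (fun v => H (qstrat mu pi v)) = \sum_k pi k * H k.
Proof.
apply: Rintegral_finite_law => // k k0; rewrite qstratE//.
exact: mu_quantile_interval.
Qed.

(** Only the top bid differs from [qstratE]: it takes the whole tail, so the points above the last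
    quantile no longer fall back to bid 0. *)
Lemma thstratE (k : 'I_K.+1) : k != ord0 ->
  [set v | thstrat K Q v = k] =
    if (k < K)%N then `]Q k, Q k.+1]%classic else `]Q k, +oo[%classic.
Proof.
move=> k0; have k0' : (0 < k)%N by rewrite lt0n.
have kK : (k <= K)%N by rewrite -ltnS.
have thP j v : (0 < j <= K)%N -> (j <= thstrat K Q v)%N = (Q j < v).
  apply: thstratP => a b /andP[ab bK]; apply: quantile_Pi_le.
  by rewrite ab (leq_trans bK).
have thk v : (thstrat K Q v = k) <-> (k <= thstrat K Q v)%N /\ ~~ (k < thstrat K Q v)%N.
  by rewrite -leqNgt; split=> [->|[kt tk]] //; apply/val_inj/eqP; rewrite eqn_leq tk.
case: ltnP => kK'; apply/seteqP; split => v /=; rewrite in_itv/= thk thP ?k0'// ?andbT.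
- by rewrite thP// -leNgt => -[-> ->].
- by rewrite thP// -leNgt => /andP[].
- by case.
- by move=> ->; split=> //; rewrite -leqNgt (leq_trans _ kK')// -ltnS.
Qed.

Lemma Rintegral_thstrat (H : 'I_K.+1 -> R) :
  Rintegral mu setT (fun v => H (thstrat K Q v)) = \sum_k pi k * H k.
Proof.
apply: Rintegral_finite_law => // k k0; rewrite thstratE//; case: ifP => // kK.
  exact: mu_quantile_interval.
have {}kK : k = ord_max.
  by apply/val_inj/eqP; rewrite eqn_leq -ltnS ltn_ord leqNgt kK.
rewrite -setCitvl probability_setC//.
transitivity (1 - (cdf mu (Q k))%:E)%E; first by rewrite cdfE.
rewrite cdf_quantile_Pi ?(ltnW (ltn_ord k))//.
rewrite -EFinB -(Pi_full pi_simplex); congr (_%:E).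
by rewrite (_ : Pi pi K.+1 = Pi pi k.+1) ?{1}kK// PiS addrAC subrr add0r.
Qed.

End QuantileStrategies.

(** * Expectations over bid profiles *)

Section Profiles.
Context {n K : nat}.
Implicit Types (b : profile n K) (i j : 'I_n).

Lemma upd_upd b i c c' : upd (upd b i c) i c' = upd b i c'.
Proof. by apply/ffunP => j; rewrite !ffunE; case: eqP. Qed.

Lemma upd_id b i : upd b i (b i) = b.
Proof. by apply/ffunP => j; rewrite !ffunE; case: eqP => // ->. Qed.

Lemma updC b i j c c' : i != j -> upd (upd b i c) j c' = upd (upd b j c') i c.
Proof.
move=> ij; apply/ffunP => l; rewrite !ffunE.
by case: (eqVneq l j) => // ->; rewrite eq_sym (negbTE ij).
Qed.

Context {R : realType}.

(** The conditional expectation given the bids of the others. *)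
Definition resample (q : {ffun 'I_K.+1 -> R}) i (G : profile n K -> R) b : R :=
  \sum_k q k * G (upd b i k).

Variable p : 'I_n -> {ffun 'I_K.+1 -> R}.
Hypothesis p_simplex : forall i, in_simplex (p i).

Definition resample_seq (l : seq 'I_n) (G : profile n K -> R) : profile n K -> R :=
  foldr (fun i F => resample (p i) i F) G l.

Definition profileE (G : profile n K -> R) : R :=
  resample_seq (enum 'I_n) G [ffun=> ord0].

Implicit Types (F G : profile n K -> R) (l : seq 'I_n).

Lemma resample_cst i G b : (forall c, G (upd b i c) = G b) ->
  resample (p i) i G b = G b.
Proof.
move=> Gi; rewrite /resample; under eq_bigr do rewrite Gi.
by rewrite -mulr_suml (p_simplex i).2 mul1r.
Qed.

Lemma resample_idem i G :
  resample (p i) i (resample (p i) i G) = resample (p i) i G.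
Proof.
apply/funext => b; apply: resample_cst => c.
by apply: eq_bigr => k _; rewrite upd_upd.
Qed.

Lemma resampleC i j G :
  resample (p i) i (resample (p j) j G) = resample (p j) j (resample (p i) i G).
Proof.
have [->//|ij] := eqVneq i j.
apply/funext => b; rewrite /resample.
under eq_bigr do rewrite mulr_sumr.
rewrite exchange_big/=; apply: eq_bigr => k _; rewrite mulr_sumr.
by apply: eq_bigr => k' _; rewrite mulrCA updC.
Qed.

Lemma resample_seqC l i G :
  resample_seq l (resample (p i) i G) = resample (p i) i (resample_seq l G).
Proof. by elim: l => //= j l ->; rewrite resampleC. Qed.

(** Resampling operators commute and are idempotent, so the extra one moves next to its twin in [l]
    and is absorbed. *)
Lemma resample_seq_absorb l i G : i \in l ->
  resample_seq l (resample (p i) i G) = resample_seq l G.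
Proof.
elim: l => //= j l IHl; rewrite in_cons => /predU1P[<-|/IHl->//].
by rewrite resample_seqC resample_idem.
Qed.

Lemma resample_seq_sum l (I : Type) (r : seq I) (F : I -> profile n K -> R) :
  resample_seq l (fun b => \sum_(a <- r) F a b)
    = fun b => \sum_(a <- r) resample_seq l (F a) b.
Proof.
elim: l => //= j l ->; apply/funext => b; rewrite /resample/=.
by under eq_bigr do rewrite mulr_sumr; rewrite exchange_big.
Qed.

Lemma resample_seqD l F G :
  resample_seq l (fun b => F b + G b)
    = fun b => resample_seq l F b + resample_seq l G b.
Proof.
elim: l => //= j l ->; apply/funext => b; rewrite /resample/=.
by under eq_bigr do rewrite mulrDr; rewrite big_split.
Qed.

Lemma resample_seq_cst l c : resample_seq l (fun=> c) = fun=> c.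
Proof. by elim: l => //= j l ->; apply/funext => b; rewrite resample_cst. Qed.

Lemma le_resample_seq l F G b : (forall b, F b <= G b) ->
  resample_seq l F b <= resample_seq l G b.
Proof.
move=> FG; elim: l b => //= j l IHl b; apply: ler_sum => k _.
by apply: ler_wpM2l => //; exact: (p_simplex j).1.
Qed.

Lemma resample_seq_local l G b b' : (forall j, j \notin l -> b j = b' j) ->
  resample_seq l G b = resample_seq l G b'.
Proof.
elim: l b b' => /= [|i l IHl] b b' bb'; first by congr G; apply/ffunP => j; exact: bb'.
apply: eq_bigr => k _; congr (_ * _); apply: IHl => j jl; rewrite !ffunE.
by case: eqVneq => // ji; apply: bb'; rewrite in_cons negb_or ji.
Qed.

(** Tower property: the bid of one bidder may be averaged first, the others held fixed. *)
Lemma profileE_resample i G : profileE (resample (p i) i G) = profileE G.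
Proof. by rewrite /profileE resample_seq_absorb// mem_enum. Qed.

Lemma profileE_sum (I : Type) (r : seq I) (F : I -> profile n K -> R) :
  profileE (fun b => \sum_(a <- r) F a b) = \sum_(a <- r) profileE (F a).
Proof. by rewrite /profileE resample_seq_sum. Qed.

Lemma profileED F G : profileE (fun b => F b + G b) = profileE F + profileE G.
Proof. by rewrite /profileE resample_seqD. Qed.

Lemma profileE_cst c : profileE (fun=> c) = c.
Proof. by rewrite /profileE resample_seq_cst. Qed.

Lemma le_profileE F G : (forall b, F b <= G b) -> profileE F <= profileE G.
Proof. exact: le_resample_seq. Qed.

(** Turns iterated integrals over values into finite sums, using only the law of each bid. Applied
    to [qstrat] in the game and to [thstrat] in the benchmark, it brings both to the same
    [profileE]. *)
Lemma prodE_profileE (D : 'I_n -> probability R R) (sigma : 'I_n -> R -> 'I_K.+1) G :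
  (forall i (H : 'I_K.+1 -> R),
     Rintegral (D i) setT (fun c => H (sigma i c)) = \sum_k p i k * H k) ->
  prodE D (fun v => G [ffun i => sigma i (v i)]) = profileE G.
Proof.
move=> law; pose phi (v : 'I_n -> R) : profile n K := [ffun i => sigma i (v i)].
have step l v : prodE_l D l (fun v => G (phi v)) v = resample_seq l G (phi v).
  elim: l v => //= i l IHl v.
  under eq_Rintegral => c _.
    rewrite IHl (_ : phi _ = upd (phi v) i (sigma i c)); first over.
    by apply/ffunP => j; rewrite !ffunE /updv; case: eqP => // ->.
  exact: (law i (fun k => resample_seq l G (upd (phi v) i k))).
(* The zero value vector need not yield the profile [[ffun=> ord0]], but every coordinate gets
   resampled. *)
rewrite /prodE step; apply: resample_seq_local => j.
by rewrite mem_enum.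
Qed.

End Profiles.

(** * The Myerson benchmark *)

Section MyersonBound.
Context {R : realType} {n : nat} (D : 'I_n -> probability R R).
Hypothesis D01 : forall i, D i `[0, 1]%classic = 1%E.

Lemma prodE_bounded (f : ('I_n -> R) -> R) (C : R) : 0 <= C ->
  (forall v, in01 v -> 0 <= f v <= C) -> 0 <= prodE D f <= C.
Proof.
move=> C0 fC; rewrite /prodE.
have : in01 (fun _ : 'I_n => 0 : R) by move=> j; rewrite lexx ler01.
elim: (enum 'I_n) (fun=> _) => [|i l IHl] v v01 /=; first exact: fC.
apply: (Rintegral_bounded _ (D01 i)) => // c; rewrite /= in_itv/= => c01.
by apply: IHl => j; rewrite /updv; case: eqP.
Qed.

Lemma Rev_le_Mye (M : cauction n R) :
  cauction_wf M -> IC M -> IR M -> Rev D M <= Mye D.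
Proof.
move=> wfM icM irM; apply: ub_le_sup; last by exists M.
(* Payments are at most 1, so [n] bounds all revenues and [sup] is a genuine supremum. *)
exists n%:R => _ [M' [wfM' _ _ ->]].
have /andP[] // : 0 <= Rev D M' <= n%:R.
apply: prodE_bounded => // v /wfM'[_ _ p01]; apply/andP; split.
  by apply: sumr_ge0 => i _; case/andP: (p01 i).
rewrite -[n in n%:R]card_ord -sumr_const.
by apply: ler_sum => i _; case/andP: (p01 i).
Qed.

End MyersonBound.

(** * Threshold payments and regret *)

Section ThresholdPayment.
Context {R : realType} (K : nat).
Implicit Types (x p Q : nat -> R) (m : nat).

(* The payment that makes truthful bidding optimal when crossing the threshold
   [Q j] raises the allocation from [x j.-1] to [x j]. *)
Definition threshold_pay x Q m : R :=
  \sum_(j < K | (j < m)%N) (x j.+1 - x j) * Q j.+1.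

Lemma threshold_pay_ge0 x Q m :
  (forall j, (j < K)%N -> x j <= x j.+1) -> (forall j, (j < K)%N -> 0 <= Q j.+1) ->
  0 <= threshold_pay x Q m.
Proof.
move=> xle Q0; apply: sumr_ge0 => j _; apply: mulr_ge0; last exact: Q0.
by rewrite subr_ge0 xle.
Qed.

(** Telescoping [x m] splits the utility into one term per crossed threshold; for nondecreasing [x]
    its sign is governed by [v - Q j.+1]. *)
Lemma threshold_utility x Q m v : (m <= K)%N ->
  x m * v - threshold_pay x Q m =
  x 0 * v + \sum_(j < K | (j < m)%N) (x j.+1 - x j) * (v - Q j.+1).
Proof.
move=> mK; rewrite /threshold_pay.
under [X in _ = _ + X]eq_bigr do rewrite mulrBr.
rewrite sumrB -mulr_suml addrA -mulrDl; congr (_ * _ - _).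
rewrite -(big_ord_widen K (fun j => x j.+1 - x j))//.
by rewrite -(big_mkord xpredT (fun j => x j.+1 - x j)) telescope_sumr// addrC subrK.
Qed.

Section Incentives.
Variables (x Q : nat -> R).
Hypothesis x_le : forall j, (j < K)%N -> x j <= x j.+1.
Hypothesis Q_le : forall a b, (a <= b <= K)%N -> Q a <= Q b.

Let util c v := x (thstrat K Q c) * v - threshold_pay x Q (thstrat K Q c).

Let utilE c v :
  util c v = x 0 * v
    + \sum_(j < K) (if Q j.+1 < c then (x j.+1 - x j) * (v - Q j.+1) else 0).
Proof.
rewrite /util threshold_utility; last by rewrite -ltnS.
by congr (_ + _); rewrite big_mkcond; apply: eq_bigr => j _; rewrite thstratP/=.
Qed.

(** Termwise comparison: the report only selects which terms count, and the truthful one keeps those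
    with [Q j.+1 < v], dropping only nonpositive terms. *)
Lemma threshold_IC c v : util c v <= util v v.
Proof.
rewrite !utilE lerD2l; apply: ler_sum => j _.
have dj : 0 <= x j.+1 - x j by rewrite subr_ge0 x_le.
case: ltP => jc; case: ltP => jv //.
  by rewrite mulr_ge0_le0// subr_le0.
by rewrite mulr_ge0// subr_ge0 ltW.
Qed.

Lemma threshold_IR v : 0 <= x 0 -> 0 <= v -> 0 <= util v v.
Proof.
move=> x0 v0; rewrite utilE addr_ge0 ?mulr_ge0//.
apply: sumr_ge0 => j _; case: ltP => // jv.
by rewrite mulr_ge0// subr_ge0 ?x_le// ltW.
Qed.

End Incentives.

Context (mu : probability R R) (pi : {ffun 'I_K.+1 -> R}).
Let Q j := quantile mu (Pi pi j).

Lemma grewardE x p (k : 'I_K.+1) :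
  greward mu x p pi k
    = x K - threshold_pay x Q K + threshold_pay x Q k - p k.
Proof.
rewrite ffunE; congr (_ - _); rewrite addrC -addrA; congr (_ + _).
have -> : threshold_pay x Q K = \sum_(j < K) (x j.+1 - x j) * Q j.+1.
  by apply: eq_bigl => j; rewrite ltn_ord.
(* Index 0 of the sum in [greward] fails [k < j] and drops out, the others shift by one; the tail
   beyond [k] is then the full sum minus its head. *)
rewrite big_mkcond big_ord_recl/= add0r [X in - X](bigID (fun j : 'I_K => (j < k)%N))/=.
rewrite opprD addrAC addNr add0r big_mkcond/= -sumrN.
rewrite [RHS]big_mkcond; apply: eq_bigr => j _; rewrite /bump/= add1n ltnS -leqNgt.
by case: ifP => // _; rewrite -mulNr opprB.
Qed.

Hypothesis pi_simplex : in_simplex pi.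

(* By [grewardE] the reward differs by a constant from
   [threshold_pay x Q k - p k]: the regret against always bidding 0 is exactly
   the excess of the expected payment over the expected threshold payment. *)
Lemma regret_gap x p : p 0 = 0 ->
  \sum_k pi k * p k =
    (greward mu x p pi ord0 - \sum_k pi k * greward mu x p pi k)
    + \sum_k pi k * threshold_pay x Q k.
Proof.
move=> p0; set C := x K - threshold_pay x Q K.
have -> : \sum_k pi k * greward mu x p pi k =
    C + \sum_k pi k * threshold_pay x Q k - \sum_k pi k * p k.
  rewrite -[C in RHS]mul1r -pi_simplex.2 mulr_suml -big_split/= -sumrB.
  by apply: eq_bigr => k _; rewrite grewardE -/C; ring.
have P0 : threshold_pay x Q 0 = 0 by rewrite /threshold_pay big_pred0.
by rewrite grewardE -/C P0 p0; ring.
Qed.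

(** The regret guarantee covers only rewards in this range. Monotonicity of the threshold payment in
    the bid gives the upper bound; for the lower one, the top bid is optimal at value 1, which
    leaves at least [x k - p k]. *)
Lemma greward_bounded x p (k : 'I_K.+1) :
  mu `[0, 1]%classic = 1%E ->
  (forall j, (j <= K)%N -> 0 <= x j <= 1) -> (forall j, (j <= K)%N -> 0 <= p j <= 1) ->
  (forall j, (j < K)%N -> x j <= x j.+1) ->
  -1 <= greward mu x p pi k <= 1.
Proof.
move=> mu01 x01 p01 xle; have kK : (k <= K)%N by rewrite -ltnS.
have Q01 j : (j < K)%N -> 0 <= Q j.+1 <= 1.
  move=> jK; have y1 := Pi_le1 pi_simplex (leqW jK).
  by rewrite quantile_ge0// quantile_le1.
have le_sum (c : nat -> R) : (forall j, (j < K)%N -> 0 <= c j) ->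
    \sum_(j < K | (j < k)%N) c j <= \sum_(j < K | (j < K)%N) c j.
  move=> c0; rewrite [leRHS](bigID (fun j : 'I_K => (j < k)%N))/=.
  under [X in _ <= X + _]eq_bigl do rewrite ltn_ord/=.
  by rewrite lerDl sumr_ge0// => j _; exact: c0.
have payle : threshold_pay x Q k <= threshold_pay x Q K.
  apply: (le_sum (fun j => (x j.+1 - x j) * Q j.+1)) => j jK.
  by rewrite mulr_ge0 ?subr_ge0 ?xle//; case/andP: (Q01 j jK).
have utille : x k - threshold_pay x Q k <= x K - threshold_pay x Q K.
  rewrite -[x k]mulr1 -[x K]mulr1 !threshold_utility// lerD2l.
  apply: (le_sum (fun j => (x j.+1 - x j) * (1 - Q j.+1))) => j jK.
  by rewrite mulr_ge0 ?subr_ge0 ?xle//; case/andP: (Q01 j jK).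
rewrite grewardE.
have /andP[xk0 _] := x01 k kK; have /andP[_ xK1] := x01 K (leqnn K).
have /andP[pk0 pk1] := p01 k kK.
by apply/andP; split; lra.
Qed.
End ThresholdPayment.

(** * Regret along a reward history *)

Section Regret.
Context {R : realType} {K : nat} (A : algo K R).

Definition gap (pi r : {ffun 'I_K.+1 -> R}) : R :=
  r ord0 - \sum_k pi k * r k.

(** The comparator is action 0, always bidding 0, because [regret_gap] measures the excess payment
    against it. *)
Definition regret0 (s : seq {ffun 'I_K.+1 -> R}) : R :=
  \sum_(t < size s) gap (A (take t s)) (nth 0 s t).

Lemma regret0_rcons (s : seq {ffun 'I_K.+1 -> R}) r : regret0 (rcons s r) = regret0 s + gap (A s) r.
Proof.
rewrite /regret0 size_rcons big_ord_recr/= nth_rcons ltnn eqxx.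
rewrite -cats1 take_size_cat//; congr (_ + _); apply: eq_bigr => t _.
by rewrite takel_cat 1?ltnW// nth_cat ltn_ord.
Qed.

Lemma regret0_le (s : seq {ffun 'I_K.+1 -> R}) Reg : regret_le A (size s) Reg ->
  (forall r, r \in s -> forall k, -1 <= r k <= 1) -> regret0 s <= Reg.
Proof.
(* The finite history is continued by 0; with horizon [size s] the guarantee reads only the actual
   entries. *)
move=> /(_ (nth 0 s)) H s1.
have /(_ ord0) := H (fun t k ts => s1 _ (mem_nth 0 ts) k).
apply: le_trans; rewrite le_eqVlt; apply/orP; left; apply/eqP.
apply: eq_bigr => t _; rewrite /gap; congr (_ - _); apply: eq_bigr => k _.
rewrite (_ : mkseq _ _ = take t s)//.
apply: (@eq_from_nth _ 0); first by rewrite size_mkseq size_take ltn_ord.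
by move=> i; rewrite size_mkseq => it; rewrite nth_mkseq// nth_take.
Qed.

End Regret.

(** * A single round *)

Section Round.
Context {R : realType} {n K : nat} (D : 'I_n -> probability R R).
Hypothesis D01 : forall i, D i `[0, 1]%classic = 1%E.
Hypothesis D_atomless : forall i (x : R), D i [set x] = 0%E.
Variables (M : format n K R) (pi : 'I_n -> {ffun 'I_K.+1 -> R}).
Hypothesis M_valid : valid_format M.
Hypothesis pi_simplex : forall i, in_simplex (pi i).
Implicit Types (b : profile n K) (i : 'I_n).

Definition alloc i b (c : nat) : R := fx M (upd b i (inord c)) i.
Definition pay i b (c : nat) : R := fp M (upd b i (inord c)) i.
Let Q i (j : nat) := quantile (D i) (Pi (pi i) j).

(** The allocation curve a bidder faces is fixed by the bids of the others, so the own report only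
    chooses a point on it. *)
Lemma alloc_upd i b k : alloc i (upd b i k) = alloc i b.
Proof. by apply/funext => c; rewrite /alloc upd_upd. Qed.

Lemma alloc_self i b : alloc i b (b i) = fx M b i.
Proof. by rewrite /alloc inord_val upd_id. Qed.

Lemma alloc01 i b c : 0 <= alloc i b c <= 1.
Proof.
have [x0 x1 _ _ _] := M_valid; rewrite x0/=; apply: le_trans (x1 (upd b i (inord c))).
by rewrite (bigD1 i)//= lerDl sumr_ge0// => j _; exact: x0.
Qed.

Lemma alloc_le i b c : (c < K)%N -> alloc i b c <= alloc i b c.+1.
Proof.
have [_ _ _ xle _] := M_valid => cK; apply: xle.
by rewrite !inordK ?ltnS// ltnW.
Qed.

Lemma pay01 i b c : 0 <= pay i b c <= 1.
Proof. by have [_ _ p01 _ _] := M_valid; exact: p01. Qed.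

Lemma pay0 i b : pay i b 0 = 0.
Proof.
have [_ _ _ _ p0] := M_valid; rewrite /pay (_ : inord 0 = ord0)//.
by apply/val_inj; rewrite /= inordK.
Qed.

Let Q_le i (a b : nat) : (a <= b <= K)%N -> Q i a <= Q i b.
Proof.
move=> /andP[ab bK]; apply: (quantile_Pi_le (D01 i) (pi_simplex i)).
by rewrite ab (leq_trans bK).
Qed.

Let Q_ge0 i j : (j < K)%N -> 0 <= Q i j.+1.
Proof.
by move=> jK; apply: (quantile_ge0 (D01 i)); exact: (Pi_le1 (pi_simplex i) (leqW jK)).
Qed.

Definition thbids (v : 'I_n -> R) : profile n K :=
  [ffun i => thstrat K (Q i) (v i)].

Lemma thbids_updv v i c : thbids (updv v i c) = upd (thbids v) i (thstrat K (Q i) c).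
Proof. by apply/ffunP => j; rewrite !ffunE /updv; case: eqP => // ->. Qed.

(** The direct mechanism compared with [Mye]; bids come from [thstrat] so that incentive
    compatibility holds at every value. *)
Definition truthful : cauction n R := CAuction
  (fun v i => fx M (thbids v) i)
  (fun v i => threshold_pay K (alloc i (thbids v)) (Q i) (thbids v i)).

Lemma truthful_utility i v c :
  cx truthful (updv v i c) i * v i - cp truthful (updv v i c) i =
  alloc i (thbids v) (thstrat K (Q i) c) * v i
    - threshold_pay K (alloc i (thbids v)) (Q i) (thstrat K (Q i) c).
Proof.
rewrite /= thbids_updv alloc_upd -alloc_self alloc_upd.
by rewrite (_ : upd _ _ _ i = thstrat K (Q i) c)// ffunE eqxx.
Qed.

Lemma truthful_utility_self i v :
  cx truthful v i * v i - cp truthful v i =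
  alloc i (thbids v) (thstrat K (Q i) (v i)) * v i
    - threshold_pay K (alloc i (thbids v)) (Q i) (thstrat K (Q i) (v i)).
Proof. by rewrite /= -alloc_self (_ : thbids v i = thstrat K (Q i) (v i)) ?ffunE. Qed.

Lemma truthful_IC : IC truthful.
Proof.
move=> i v c v01 c01; rewrite truthful_utility truthful_utility_self.
by apply: threshold_IC => [j|a b]; [exact: alloc_le|exact: Q_le].
Qed.

Lemma truthful_IR : IR truthful.
Proof.
move=> i v v01; rewrite truthful_utility_self; apply: threshold_IR.
- by move=> j; exact: alloc_le.
- exact: Q_le.
- by case/andP: (alloc01 i (thbids v) 0).
- by case/andP: (v01 i).
Qed.

Lemma truthful_wf : cauction_wf truthful.
Proof.
move=> v v01; have [x0 x1 _ _ _] := M_valid; split=> [i||i]; [exact: x0|exact: x1|].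
apply/andP; split.
  by apply: threshold_pay_ge0 => j; [exact: alloc_le|exact: Q_ge0].
(* Individual rationality bounds the payment by allocation times value, hence by 1. *)
have := truthful_IR i v01; rewrite subr_ge0 => /le_trans; apply.
have /andP[vi0 vi1] := v01 i.
rewrite /= -alloc_self mulr_ile1//.
- by case/andP: (alloc01 i (thbids v) (thbids v i)).
- by case/andP: (alloc01 i (thbids v) (thbids v i)).
Qed.

Lemma Rev_truthful : Rev D truthful =
  profileE pi (fun b => \sum_i threshold_pay K (alloc i b) (Q i) (b i)).
Proof.
apply: (prodE_profileE (sigma := fun i => thstrat K (Q i))) => // i H.
exact: Rintegral_thstrat.
Qed.

Definition round_reward i b : {ffun 'I_K.+1 -> R} :=
  greward (D i) (alloc i b) (pay i b) (pi i).

Lemma round_reward_bounded i b k : -1 <= round_reward i b k <= 1.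
Proof.
apply: greward_bounded => // j jK; [exact: alloc01|exact: pay01|exact: alloc_le].
Qed.

(** By the tower property each bidder is treated with the bids of the others fixed, where
    [regret_gap] splits the expected payment into threshold payment and one-round gap. *)
Lemma profileE_revenue :
  profileE pi (fun b => \sum_i fp M b i) =
  Rev D truthful + profileE pi (fun b => \sum_i gap (pi i) (round_reward i b)).
Proof.
rewrite Rev_truthful !profileE_sum -big_split/=; apply: eq_bigr => i _.
rewrite -(profileE_resample pi_simplex i (fun b => fp M b i)).
rewrite -[X in _ = X + _](profileE_resample pi_simplex i) -profileED.
congr profileE; apply/funext => b; rewrite addrC.
transitivity (\sum_k pi i k * pay i b k).
  by apply: eq_bigr => k _; rewrite /pay inord_val.
rewrite (regret_gap (D i) (pi_simplex i) (alloc i b) (pay0 i b)); congr (_ + _).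
by apply: eq_bigr => k _; rewrite alloc_upd ffunE eqxx.
Qed.

End Round.

(** * The repeated game *)

Section RepeatedGame.
Context {R : realType} {n K : nat} (D : 'I_n -> probability R R).
Hypothesis D01 : forall i, D i `[0, 1]%classic = 1%E.
Hypothesis D_atomless : forall i (x : R), D i [set x] = 0%E.
Variables (A : 'I_n -> algo K R) (auct : seq (profile n K) -> format n K R).
Hypothesis A_simplex : forall i h, in_simplex (A i h).
Hypothesis auct_valid : forall h, valid_format (auct h).
Implicit Types h : seq (profile n K).

Let pi h i := A i (rewards D A auct i h).
Let pi_simplex h i : in_simplex (pi h i). Proof. exact: A_simplex. Qed.

Lemma rewards_cons i b h : rewards D A auct i (b :: h) =
  rcons (rewards D A auct i h) (round_reward D (auct h) (pi h) i b).
Proof. by []. Qed.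

Lemma size_rewards i h : size (rewards D A auct i h) = size h.
Proof. by elim: h => //= b h IHh; rewrite size_rcons IHh. Qed.

Lemma rewards_bounded i h r : r \in rewards D A auct i h ->
  forall k, -1 <= r k <= 1.
Proof.
elim: h => // b h IHh; rewrite rewards_cons mem_rcons in_cons => /predU1P[-> k|//].
exact: round_reward_bounded.
Qed.

Lemma exp_revS t h : exp_rev D A auct t.+1 h =
  profileE (pi h) (fun b => \sum_i fp (auct h) b i + exp_rev D A auct t (b :: h)).
Proof.
apply: (prodE_profileE (sigma := strat D A auct ^~ h)) => i H.
exact: Rintegral_qstrat.
Qed.

Lemma exp_rev_ge0 t h : 0 <= exp_rev D A auct t h.
Proof.
elim: t h => // t IHt h; rewrite exp_revS -[leLHS](profileE_cst (pi_simplex h)).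
apply: (le_profileE (pi_simplex h)) => b; apply: addr_ge0 => //; apply: sumr_ge0 => i _.
by have [_ _ /(_ b i)/andP[]] := auct_valid h.
Qed.

(** Induction on the remaining rounds, with the regret accrued so far as a potential. A round earns
    at most [Mye D] plus the expected growth of the potential. After [T] rounds the guarantee bounds
    the potential on each realized history, which covers adaptive formats. *)
Lemma exp_rev_le T (Reg : 'I_n -> R) t h :
  (forall i, regret_le (A i) T (Reg i)) -> (t + size h)%N = T ->
  exp_rev D A auct t h + \sum_i regret0 (A i) (rewards D A auct i h)
    <= Mye D * t%:R + \sum_i Reg i.
Proof.
move=> A_reg; elim: t h => [|t IHt] h th.
  rewrite /= add0r mulr0 add0r; apply: ler_sum => i _.
  apply: regret0_le; first by rewrite size_rewards -[size h]add0n th.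
  exact: rewards_bounded.
pose past := \sum_i regret0 (A i) (rewards D A auct i h).
pose gaps b := \sum_i gap (pi h i) (round_reward D (auct h) (pi h) i b).
have IH b : exp_rev D A auct t (b :: h) + gaps b + past <= Mye D * t%:R + \sum_i Reg i.
  apply: le_trans (IHt (b :: h) _); last by rewrite -th addnS.
  rewrite -addrA lerD2l -big_split/= le_eqVlt; apply/orP; left; apply/eqP.
  by apply: eq_bigr => i _; rewrite regret0_rcons addrC.
(* Averaging the induction hypothesis over the bids of the round produces the expected gaps, which
   match those in [profileE_revenue]. *)
have := le_profileE (pi_simplex h) IH.
rewrite (profileE_cst (pi_simplex h)) !profileED (profileE_cst (pi_simplex h)).
rewrite exp_revS profileED (profileE_revenue D01 D_atomless (auct_valid h) (pi_simplex h)).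
have := Rev_le_Mye D01 (truthful_wf D01 (auct_valid h) (pi_simplex h))
  (truthful_IC D01 (auct_valid h) (pi_simplex h))
  (truthful_IR D01 (auct_valid h) (pi_simplex h)).
by rewrite -/past -[t.+1]addn1 natrD mulrDr mulr1 /gaps; lra.
Qed.

End RepeatedGame.

Theorem mainTheorem1 (R : realType) (n K T : nat)
  (hn : (0 < n)%N) (hK : (0 < K)%N) (hT : (0 < T)%N)
  (D : 'I_n -> probability R R)
  (hD01 : forall i, D i `[0, 1]%classic = 1%E)
  (hDcont : forall i (x : R), D i [set x] = 0%E)
  (A : 'I_n -> algo K R) (Reg : 'I_n -> R)
  (hAsimplex : forall i h, in_simplex (A i h))
  (hAreg : forall i, regret_le (A i) T (Reg i))
  (d : measure_display) (S : measurableType d) (PS : probability S R)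
  (auct : S -> seq (profile n K) -> format n K R)
  (hauct : forall s h, valid_format (auct s h)) :
  Rintegral PS setT (fun s => exp_rev D A (auct s) T [::])
    <= Mye D * T%:R + \sum_(i < n) Reg i.
Proof.
have rev_le s : 0 <= exp_rev D A (auct s) T [::] <= Mye D * T%:R + \sum_(i < n) Reg i.
  rewrite exp_rev_ge0//=.
  have := @exp_rev_le _ _ _ D hD01 hDcont A (auct s) hAsimplex (hauct s) T Reg T [::]
    hAreg (addn0 T).
  by rewrite big1 ?addr0// => i _; rewrite /regret0 big_ord0.
(* [Rintegral_bounded] asks for a nonnegative bound; a single seed, here [point], provides it. *)
have bound_ge0 : 0 <= Mye D * T%:R + \sum_(i < n) Reg i.
  by have /andP[rev0 /(le_trans rev0)] := rev_le point.
by have /andP[] := Rintegral_bounded measurableT (probability_setT PS) bound_ge0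
  (fun s _ => rev_le s).
Qed.
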